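(* Let $A\in\mathbb{C}^{p\times p}$, $B\in\mathbb{C}^{q\times q}$, $C\in\mathbb{C}^{p\times q}$, and let $m\ge k=\mathrm{Ind}(A)$ and $n\ge l=\mathrm{Ind}(B)$ be integers. Let $(A^{m})^{(1)}$ and $(B^{n})^{(1)}$ be $\{1\}$-inverses of $A^m$ and $B^n$ respectively. If the matrix equation $A^{m}XB^{n}=C$ (in the unknown $X\in\mathbb{C}^{p\times q}$) is consistent, then its general solution is given by the formula $$X=f(Y)=(A^{m})^{(1)}C(B^{n})^{(1)}+Y-(A^{m})^{(1)}A^{m}YB^{n}(B^{n})^{(1)},$$ where $Y\in\mathbb{C}^{p\times q}$ is arbitrary; that is, for every $Y\in\mathbb{C}^{p\times q}$ the matrix $f(Y)$ is a solution, and every solution $X$ is of the form $X=f(Y)$ for some $Y\in\mathbb{C}^{p\times q}$.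
   Context: For a complex matrix $M\in\mathbb{C}^{a\times b}$, a $\{1\}$-inverse of $M$ is any matrix $M^{(1)}\in\mathbb{C}^{b\times a}$ with $MM^{(1)}M=M$; it always exists but in general is not unique. For a square matrix $M$, the index $\mathrm{Ind}(M)$ is the smallest non-negative integer $k$ with $\mathrm{rank}(M^k)=\mathrm{rank}(M^{k+1})$ (with $M^0=I$). An equation is consistent if it has at least one solution. A formula $X=\phi(Y)$ represents the general solution of an equation if $\phi(Y)$ is a solution for every $Y$, and every solution $X$ equals $\phi(Y)$ for some $Y$. *)

(* Defs.v *)
From HB Require Import structures.
From mathcomp Require Import all_boot all_order all_algebra.
From mathcomp Require Import reals complex.

Set Implicit Arguments.
Unset Strict Implicit.
Unset Printing Implicit Defensive.

Import Order.TTheory GRing.Theory Num.Theory.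
Local Open Scope ring_scope.

Definition inv1 (F : fieldType) (a b : nat) (M : 'M[F]_(a, b))
    (N : 'M[F]_(b, a)) : Prop :=
  M *m N *m M = M.

Lemma ex_mxindex (F : fieldType) (n : nat) (M : 'M[F]_n) :
  exists k, \rank (M ^+ k) == \rank (M ^+ k.+1).
Proof.
have le_rank k : (\rank (M ^+ k.+1) <= \rank (M ^+ k))%N.
  by rewrite exprS; apply: mxrankM_maxr.
suff H r k : (\rank (M ^+ k) <= r)%N ->
    exists k, \rank (M ^+ k) == \rank (M ^+ k.+1) by exact: (H _ 0%N).
elim: r k => [|r IHr] k ler.
  have ler' := leq_trans (le_rank k) ler.
  by exists k; move: ler ler'; rewrite !leqn0 => /eqP -> /eqP ->.
have [eq_k | ne_k] := eqVneq (\rank (M ^+ k)) (\rank (M ^+ k.+1)).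
  by exists k; apply/eqP.
apply: (IHr k.+1); rewrite -ltnS; apply: leq_trans ler.
by rewrite ltn_neqAle eq_sym ne_k le_rank.
Qed.

Definition mxindex (F : fieldType) (n : nat) (M : 'M[F]_n) : nat :=
  ex_minn (ex_mxindex M).

(* Main.v *)
Require Import Defs.
From HB Require Import structures.
From mathcomp Require Import all_boot all_order all_algebra.
From mathcomp Require Import reals complex.

Set Implicit Arguments.
Unset Strict Implicit.
Unset Printing Implicit Defensive.

Import Order.TTheory GRing.Theory Num.Theory.
Local Open Scope ring_scope.
Local Open Scope complex_scope.

(** Write [M] for [A ^+ m] and [N] for [B ^+ n]. The map [X |-> M *m X *m N] has
    [Z |-> Am1 *m Z *m Bn1] as a {1}-inverse, which is what [inv1_sandwich] says. Consistency puts
    [C] in the range of the map, so [Am1 *m C *m Bn1] is a particular solution, and the rest of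
    [f Y] lies in the kernel. *)

Lemma inv1_sandwich (F : fieldType) (a b c d : nat)
    (M : 'M[F]_(a, b)) (N : 'M[F]_(c, d)) (M1 : 'M[F]_(b, a))
    (N1 : 'M[F]_(d, c)) (X : 'M[F]_(b, c)) :
  inv1 M M1 -> inv1 N N1 ->
  M *m (M1 *m (M *m X *m N) *m N1) *m N = M *m X *m N.
Proof.
move=> hM hN.
(* [M *m M1 *m M] collapses on the left, then [N *m N1 *m N], once regrouped, on the right. *)
by rewrite !mulmxA hM -(mulmxA _ N N1) -(mulmxA _ (N *m N1) N) hN.
Qed.

Theorem theorem2p1 (R : realType) (p q : nat)
    (A : 'M[R[i]]_p) (B : 'M[R[i]]_q) (C : 'M[R[i]]_(p, q))
    (k l m n : nat)
    (hk : k = mxindex A) (hl : l = mxindex B)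
    (hm : (k <= m)%N) (hn : (l <= n)%N)
    (Am1 : 'M[R[i]]_p) (Bn1 : 'M[R[i]]_q)
    (hAm1 : inv1 (A ^+ m) Am1) (hBn1 : inv1 (B ^+ n) Bn1)
    (hcons : exists X : 'M[R[i]]_(p, q), A ^+ m *m X *m B ^+ n = C) :
  let f := fun Y : 'M[R[i]]_(p, q) =>
    Am1 *m C *m Bn1 + Y - Am1 *m A ^+ m *m Y *m B ^+ n *m Bn1 in
  (forall Y : 'M[R[i]]_(p, q), A ^+ m *m f Y *m B ^+ n = C) /\
  (forall X : 'M[R[i]]_(p, q), A ^+ m *m X *m B ^+ n = C ->
    exists Y : 'M[R[i]]_(p, q), X = f Y).
Proof.
move=> f; split=> [Y | X hX].
  have [X0 hX0] := hcons.
  rewrite /f -hX0 mulmxBr mulmxBl mulmxDr mulmxDl inv1_sandwich //.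
  (* The subtracted term maps to [A ^+ m *m Y *m B ^+ n], the image of [Y] itself, so the two
     cancel. *)
  have := inv1_sandwich Y hAm1 hBn1; rewrite !mulmxA => ->.
  by rewrite addrK.
(* A solution is its own parameter: with [C] expanded through [hX], the first and last terms of
   [f X] cancel. *)
by exists X; rewrite /f -hX !mulmxA addrAC subrr add0r.
Qed.
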